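(* Let $\mathsf R$ be a multivariate Ore extension of a domain $R$, let $F=\{g_1,\dots,g_u\}\subset\mathsf R^m\setminus\{0\}$ be a finite set which is a left Gröbner basis of $\mathsf M:=\mathbb I_L(F)$, and let $\mathfrak{GM}(F)$ be a left Gebauer–Möller set for $F$ (so that each $\sigma\in\mathfrak{GM}(F)$ has a lifting; let $\mathrm{lift}(\sigma)$ denote one). Then $\{\mathrm{lift}(\sigma):\sigma\in\mathfrak{GM}(F)\}$ is a left standard basis of $\ker(\mathfrak S_L)$.
   Context: **Ore extensions.** $R$ is a (not necessarily commutative) domain with identity. A multivariate Ore extension $\mathsf R=R[Y_1;\alpha_1,\delta_1]\cdots[Y_n;\alpha_n,\delta_n]$ is an iterated Ore extension ($Y_i\star r=\alpha_i(r)Y_i+\delta_i(r)$, $\alpha_i$ an injective ring endomorphism mapping $R$ to $R$, $\delta_i$ an $\alpha_i$-derivation mapping $R$ to $R$, i.e. additive with $\delta_i(rr')=\alpha_i(r)\delta_i(r')+\delta_i(r)r'$) such that $\alpha_j\delta_i=\delta_i\alpha_j$ for $i\ne j$, $\alpha_i\alpha_j=\alpha_j\alpha_i$, $\delta_i\delta_j=\delta_j\delta_i$, and $\alpha_j(Y_i)=Y_i$, $\delta_j(Y_i)=0$ for $i<j$. Its multiplication is $\star$. It is a free left $R$-module on the set of terms $\mathcal T=\{Y_1^{a_1}\cdots Y_n^{a_n}\}$, a commutative monoid whose product is written $\circ$. For $\tau=Y_1^{a_1}\cdots Y_n^{a_n}$ put $\alpha_\tau=\alpha_1^{a_1}\cdots\alpha_n^{a_n}:R\to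 R$. The associated graded Ore extension $\mathsf S=R[Y_1;\alpha_1]\cdots[Y_n;\alpha_n]$ is the same left $R$-module with multiplication $\ast$ determined by $(a\tau)\ast(b\omega)=a\,\alpha_\tau(b)\,\tau\circ\omega$. **Orderings.** $\mathsf R^m$ has canonical basis $\mathbf e_1,\dots,\mathbf e_m$ and terms $\mathcal T^{(m)}=\{t\mathbf e_i\}$. Fix a term ordering $\prec$ on $\mathcal T$ and a compatible term ordering $<$ on $\mathcal T^{(m)}$: a well-ordering with $\omega_1\prec\omega_2\Rightarrow\omega_1t<\omega_2t$ and $t_1<t_2\Rightarrow\omega t_1<\omega t_2$. For $f\ne0$, $\mathbf T(f)$ is its maximal term, $\mathrm{lc}(f)\in R$ the coefficient of $\mathbf T(f)$, and $\mathbf M(f)=\mathrm{lc}(f)\mathbf T(f)$. **Gröbner basis.** $F$ is a left (weak) Gröbner basis of $\mathsf M=\mathbb I_L(F)$ (the left $\mathsf R$-module generated by $F$) if for every $f\in\mathsf M\setminus\{0\}$ one has $\mathbf M(f)=\sum_i a_i\lambda_i\ast\mathbf M(g_{j_i})$ (finite sum) with $a_i\in R\setminus\{0\}$, $\lambda_i\in\mathcal T$, $g_{j_i}\in F$, $\lambda_i\circ\mathbf T(g_{j_i})=\mathbf T(f)$. **Syzygies.** Let $e_1,\dots,e_u$ be the common canonical basis of $\mathsf S^u$ and $\mathsf R^u$ (equal as $R$-modules). Define $\mathfrak s_L:\mathsf S^u\to\mathsf S^m$, $\mathfrak s_L(\sum h_ie_i)=\sum h_i\ast\mathbf M(g_i)$,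 and $\mathfrak S_L:\mathsf R^u\to\mathsf R^m$, $\mathfrak S_L(\sum h_ie_i)=\sum h_i\star g_i$. For $\sigma=\sum h_ie_i\ne0$ put $v(\sigma)=\max_<\{\mathbf T(h_i)\circ\mathbf T(g_i):h_i\ne0\}$ and leading form $\mathcal L_L(\sigma)=\sum_{i\in H}\mathbf M(h_i)e_i\in\mathsf S^u$, $H=\{i:\mathbf T(h_i)\circ\mathbf T(g_i)=v(\sigma)\}$. A nonzero element $\sum a_i\lambda_ie_i$ ($a_i\in R,\lambda_i\in\mathcal T$) is $\mathcal T^{(m)}$-homogeneous if $\lambda_i\circ\mathbf T(g_i)$ is the same term for all $i$ with $a_i\neq0$. A left Gebauer–Möller set for $F$ is a set of (nonzero) $\mathcal T^{(m)}$-homogeneous generators of the left $\mathsf S$-module $\ker(\mathfrak s_L)$. A lifting of a homogeneous $\sigma\in\ker(\mathfrak s_L)$ is an element $U\in\ker(\mathfrak S_L)$ with $\mathcal L_L(U)=\sigma$. For a left $\mathsf R$-submodule $\mathsf N\subset\mathsf R^u$, a set $B\subset\mathsf N$ is a left standard basis of $\mathsf N$ if $\{\mathcal L_L(b):b\in B\setminus\{0\}\}$ and $\{\mathcal L_L(h):h\in\mathsf N\setminus\{0\}\}$ generate the same left $\mathsf S$-submodule of $\mathsf S^u$. *)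

(* Defs.v *)
From HB Require Import structures.
From mathcomp Require Import all_boot all_order all_algebra.
From mathcomp Require Export mpoly.

Set Implicit Arguments.
Unset Strict Implicit.
Unset Printing Implicit Defensive.

Import GRing.Theory.
Local Open Scope ring_scope.

(* R need not be commutative, so idomainType does not apply. *)
Definition is_domain (R : nzRingType) : Prop :=
  forall x y : R, x * y = 0 -> x = 0 \/ y = 0.

(* The data (alpha_i, delta_i) on R of a multivariate Ore extension           *)
(* R[Y_1; alpha_1, delta_1]...[Y_n; alpha_n, delta_n].  The requirements      *)
(* alpha_j(Y_i) = Y_i and delta_j(Y_i) = 0 for i < j determine alpha_j and    *)
(* delta_j on the intermediate extensions: they act coefficientwise.          *)
Record ore_data (R : nzRingType) (n : nat) := OreData {
  oalpha : 'I_n -> {rmorphism R -> R};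
  odelta : 'I_n -> {additive R -> R};
  oalpha_inj : forall i, injective (oalpha i);
  odeltaM : forall i r s,
    odelta i (r * s) = oalpha i r * odelta i s + odelta i r * s;
  oalphaC : forall i j r, oalpha i (oalpha j r) = oalpha j (oalpha i r);
  odeltaC : forall i j r, odelta i (odelta j r) = odelta j (odelta i r);
  oalpha_deltaC : forall i j, i != j ->
    forall r, oalpha j (odelta i r) = odelta i (oalpha j r)
}.

(* Only the left R-module structure of {mpoly R[n]} (free on the terms        *)
(* 'X_[t], t : 'X_{1..n}) is reused; the product is omul below.               *)
Definition ore (R : nzRingType) (n : nat) (D : ore_data R n) : Type :=
  {mpoly R[n]}.

HB.instance Definition _ R n (D : ore_data R n) :=
  GRing.Lmodule.copy (ore D) {mpoly R[n]}.

Definition omon (R : nzRingType) n (D : ore_data R n) (a : R) (t : 'X_{1..n})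
  : ore D := a *: 'X_[t].

Lemma omonZ (R : nzRingType) n (D : ore_data R n) (a b : R) t :
  a *: omon D b t = omon D (a * b) t.
Proof. exact: scalerA. Qed.

Section CoefSum.
Variables (R : nzRingType) (n : nat) (V : zmodType).
Variable F : 'X_{1..n} -> {additive R -> V}.

Lemma coef_sum_widen (s : seq 'X_{1..n}) (p : {mpoly R[n]}) :
  uniq s -> {subset msupp p <= s} ->
  \sum_(t <- msupp p) F t p@_t = \sum_(t <- s) F t p@_t.
Proof.
move=> us sub; rewrite [RHS](bigID (fun t => t \in msupp p)) /=.
rewrite [X in _ + X]big1 ?addr0; last first.
  by move=> t tn; rewrite memN_msupp_eq0 ?raddf0.
rewrite -[RHS]big_filter; apply: perm_big; apply: uniq_perm.
- exact: msupp_uniq.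
- exact: filter_uniq.
by move=> t; rewrite mem_filter; case: (boolP (t \in _)) => // /sub ->.
Qed.

Lemma coef_sumB (p q : {mpoly R[n]}) :
  \sum_(t <- msupp (p - q)) F t (p - q)@_t
  = \sum_(t <- msupp p) F t p@_t - \sum_(t <- msupp q) F t q@_t.
Proof.
pose s := undup (msupp p ++ msupp q).
have us : uniq s by exact: undup_uniq.
rewrite (coef_sum_widen us) ?(@coef_sum_widen s p) ?(@coef_sum_widen s q) //.
- by rewrite -sumrB; apply: eq_bigr => t _; rewrite mcoeffB raddfB.
- by move=> t tq; rewrite mem_undup mem_cat tq orbT.
- by move=> t tq; rewrite mem_undup mem_cat tq.
- by move=> t /msuppB_le; rewrite mem_undup.
Qed.

Lemma coef_sumX (a : R) t0 :
  \sum_(t <- msupp (a *: 'X_[R, t0])) F t (a *: 'X_[R, t0])@_t = F t0 a.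
Proof.
rewrite (@coef_sum_widen [:: t0]) //.
  by rewrite big_seq1 mcoeffZ mcoeffX eqxx mulr1.
by move=> t /msuppZ_le; rewrite msuppX.
Qed.

End CoefSum.

Section OreMul.
Variables (R : nzRingType) (n : nat) (D : ore_data R n).
Implicit Types (p q r : ore D) (s t : 'X_{1..n}) (a b : R).

(* Left multiplication by Y_i:                                                *)
(* Y_i (a t) = alpha_i(a) (Y_i o t) + delta_i(a) t.                           *)
Definition ylmul (i : 'I_n) (q : ore D) : ore D :=
  \sum_(t <- msupp q)
     (omon D (oalpha D i q@_t) (U_(i) + t)%MM + omon D (odelta D i q@_t) t).

(* Left multiplication by Y_1^t_1 ... Y_n^t_n. *)
Definition tlmul (t : 'X_{1..n}) (q : ore D) : ore D :=
  foldr (fun i => iter (t i) (ylmul i)) q (enum 'I_n).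

Definition omul (p q : ore D) : ore D :=
  \sum_(t <- msupp p) p@_t *: tlmul t q.

Definition ylmul_coef i t a : ore D :=
  omon D (oalpha D i a) (U_(i) + t)%MM + omon D (odelta D i a) t.

Lemma ylmul_coef_is_zmod_morphism i t : zmod_morphism (ylmul_coef i t).
Proof.
move=> a b; rewrite /ylmul_coef /omon !raddfB /=.
by rewrite !scalerBl opprD addrACA.
Qed.

HB.instance Definition _ i t :=
  GRing.isZmodMorphism.Build R (ore D) (ylmul_coef i t)
    (ylmul_coef_is_zmod_morphism i t).

Lemma ylmul_is_zmod_morphism i : zmod_morphism (ylmul i).
Proof. by move=> p q; exact: (coef_sumB (fun t => ylmul_coef i t)). Qed.

HB.instance Definition _ i :=
  GRing.isZmodMorphism.Build (ore D) (ore D) (ylmul i)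
    (ylmul_is_zmod_morphism i).

Lemma ylmulX i a t :
  ylmul i (omon D a t)
  = omon D (oalpha D i a) (U_(i) + t)%MM + omon D (odelta D i a) t.
Proof. exact: (coef_sumX (fun t => ylmul_coef i t)). Qed.

Lemma iter_ylmulB i k : zmod_morphism (iter k (ylmul i)).
Proof. by elim: k => // k IHk p q; rewrite !iterS IHk raddfB. Qed.

Lemma tlmul_is_zmod_morphism t : zmod_morphism (tlmul t).
Proof.
move=> p q; rewrite /tlmul.
by elim: (enum _) => //= i e ->; rewrite iter_ylmulB.
Qed.

HB.instance Definition _ t :=
  GRing.isZmodMorphism.Build (ore D) (ore D) (tlmul t)
    (tlmul_is_zmod_morphism t).

Lemma oreE p : p = \sum_(t <- msupp p) omon D p@_t t.
Proof. exact: mpolyE. Qed.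

Lemma ore_ext (f g : {additive ore D -> ore D}) :
  (forall a t, f (omon D a t) = g (omon D a t)) -> f =1 g.
Proof.
by move=> fg p; rewrite (oreE p) !raddf_sum; apply: eq_bigr => t _.
Qed.

Lemma ylmulC i j p : ylmul i (ylmul j p) = ylmul j (ylmul i p).
Proof.
case: (eqVneq i j) => [-> // | neq_ij].
apply: (ore_ext (f := ylmul i \o ylmul j) (g := ylmul j \o ylmul i)) => a t /=.
rewrite !ylmulX !raddfD /= !ylmulX oalphaC odeltaC.
rewrite !addmA (addmC U_(i)%MM U_(j)%MM).
rewrite (oalpha_deltaC D neq_ij) (@oalpha_deltaC _ _ D j i) 1?eq_sym //.
by rewrite -!addrA; congr (_ + _); rewrite addrCA.
Qed.

Lemma ylmul_iterC i j k p :
  ylmul i (iter k (ylmul j) p) = iter k (ylmul j) (ylmul i p).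
Proof. by elim: k => //= k <-; rewrite ylmulC. Qed.

Lemma tlmul0 q : tlmul 0%MM q = q.
Proof. by rewrite /tlmul; elim: (enum _) => //= i e ->; rewrite mnm0E. Qed.

Lemma tlmulS i t q : tlmul (U_(i) + t)%MM q = ylmul i (tlmul t q).
Proof.
rewrite /tlmul; have := mem_enum 'I_n i; have := enum_uniq 'I_n.
elim: (enum _) => //= j e IHe /andP[jNe ue]; rewrite in_cons mnmDE mnm1E.
have [-> _ | neq_ij /=] := eqVneq i j.
  rewrite add1n iterS; congr (ylmul _ (iter _ _ _)).
  elim: e jNe {IHe ue} => //= k e IHe; rewrite inE negb_or => /andP[njk jNe].
  by rewrite IHe // mnmDE mnm1E (negPf njk).
by move=> ie; rewrite add0n (IHe ue ie) ylmul_iterC.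
Qed.

Lemma mnm_ind (P : 'X_{1..n} -> Prop) :
  P 0%MM -> (forall i t, P t -> P (U_(i) + t)%MM) -> forall t, P t.
Proof.
move=> P0 PS t; have [k] := ubnP (mdeg t); elim: k t => // k IHk t lt_tk.
have [t0|/eqP t_neq0] := eqVneq (mdeg t) 0%N.
  by move/eqP: t0; rewrite mdeg_eq0 => /eqP ->.
have [i ti] : exists i, t i != 0%N.
  apply/existsP; apply: contra_notT t_neq0.
  rewrite negb_exists => /forallP t0; rewrite mdegE big1 // => i _.
  by apply/eqP; rewrite -[_ == _]negbK.
have Et : t = (U_(i) + (t - U_(i)))%MM by rewrite addmC submK // lep1mP.
rewrite Et; apply: PS; apply: IHk; move: lt_tk.
by rewrite {1}Et mdegD mdeg1.
Qed.

Lemma tlmulD s t q : tlmul (s + t)%MM q = tlmul s (tlmul t q).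
Proof.
elim/mnm_ind: s => [|i s IHs]; first by rewrite add0m tlmul0.
by rewrite -addmA !tlmulS IHs.
Qed.

Lemma odelta1 i : odelta D i 1 = 0.
Proof.
have := odeltaM D i 1 1; rewrite !mulr1 rmorph1 mul1r => /eqP.
by rewrite -subr_eq subrr eq_sym => /eqP.
Qed.

Lemma tlmulX t : tlmul t (omon D 1 0%MM) = omon D 1 t.
Proof.
elim/mnm_ind: t => [|i t IHt]; first by rewrite tlmul0.
by rewrite tlmulS IHt ylmulX rmorph1 odelta1 /omon scale0r addr0.
Qed.

Definition omul_coef q t a : ore D := a *: tlmul t q.

Lemma omul_coef_is_zmod_morphism q t : zmod_morphism (omul_coef q t).
Proof. by move=> a b; rewrite /omul_coef scalerBl. Qed.

HB.instance Definition _ q t :=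
  GRing.isZmodMorphism.Build R (ore D) (omul_coef q t)
    (omul_coef_is_zmod_morphism q t).

Lemma omulBl q : zmod_morphism (omul^~ q).
Proof. by move=> p1 p2; exact: (coef_sumB (fun t => omul_coef q t)). Qed.

Lemma omulBr p : zmod_morphism (omul p).
Proof.
move=> q1 q2; rewrite /omul -sumrB; apply: eq_bigr => t _.
by rewrite raddfB scalerBr.
Qed.

HB.instance Definition _ p :=
  GRing.isZmodMorphism.Build (ore D) (ore D) (omul p) (omulBr p).

Definition omulr q p := omul p q.

HB.instance Definition _ q :=
  GRing.isZmodMorphism.Build (ore D) (ore D) (omulr q) (omulBl q).

Lemma omulX a t q : omul (omon D a t) q = a *: tlmul t q.
Proof. exact: (coef_sumX (fun t => omul_coef q t)). Qed.

Lemma omulDl : left_distributive omul +%R.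
Proof. by move=> p1 p2 q; rewrite -!/(omulr q _) raddfD. Qed.

Lemma omulDr : right_distributive omul +%R.
Proof. by move=> p q1 q2; rewrite raddfD. Qed.

Lemma omul_suml (I : Type) (e : seq I) (F : I -> ore D) q :
  omul (\sum_(i <- e) F i) q = \sum_(i <- e) omul (F i) q.
Proof. exact: (raddf_sum (omulr q)). Qed.

Lemma omulZ a p q : omul (a *: p) q = a *: omul p q.
Proof.
rewrite (oreE p) scaler_sumr !omul_suml scaler_sumr.
by apply: eq_bigr => t _; rewrite omonZ !omulX scalerA.
Qed.

Lemma ylmulZ i b q :
  ylmul i (b *: q) = oalpha D i b *: ylmul i q + odelta D i b *: q.
Proof.
rewrite (oreE q) scaler_sumr !(raddf_sum (ylmul i)) !scaler_sumr -big_split /=.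
apply: eq_bigr => t _; rewrite omonZ !ylmulX rmorphM odeltaM.
by rewrite scalerDr !omonZ -addrA -scalerDl.
Qed.

Lemma omul_ylmul i p q : omul (ylmul i p) q = ylmul i (omul p q).
Proof.
rewrite (oreE p) (raddf_sum (ylmul i)) !omul_suml (raddf_sum (ylmul i)).
apply: eq_bigr => t _.
by rewrite /= ylmulX omulDl !omulX tlmulS ylmulZ.
Qed.

Lemma omul_tlmul t p q : omul (tlmul t p) q = tlmul t (omul p q).
Proof.
elim/mnm_ind: t => [|i t IHt]; first by rewrite !tlmul0.
by rewrite !tlmulS omul_ylmul IHt.
Qed.

Lemma omulA : associative omul.
Proof.
move=> p q r; rewrite (oreE p) !omul_suml; apply: eq_bigr => t _.
by rewrite !omulX omulZ omul_tlmul.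
Qed.

Lemma omul1l : left_id (omon D 1 0%MM) omul.
Proof. by move=> q; rewrite omulX scale1r tlmul0. Qed.

Lemma omul1r : right_id (omon D 1 0%MM) omul.
Proof.
move=> p; rewrite [RHS]oreE; apply: eq_bigr => t _.
by rewrite tlmulX /omon scalerA mulr1.
Qed.

Lemma ore1_neq0 : omon D 1 0%MM != 0.
Proof. by rewrite /omon scale1r mpolyX0 oner_neq0. Qed.

End OreMul.

HB.instance Definition _ R n (D : ore_data R n) :=
  GRing.Zmodule_isNzRing.Build (ore D)
    (@omulA R n D) (@omul1l R n D) (@omul1r R n D)
    (@omulDl R n D) (@omulDr R n D) (@ore1_neq0 R n D).

Section OreTheory.
Variables (R : nzRingType) (n : nat) (D : ore_data R n).

Lemma ore_scaleAl (a : R) (p q : ore D) : a *: omul p q = omul (a *: p) q.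
Proof. by exact: esym (omulZ a p q). Qed.

HB.instance Definition _ :=
  GRing.Lmodule_isLalgebra.Build R (ore D) ore_scaleAl.

Definition oreY (i : 'I_n) : ore D := omon D 1 U_(i)%MM.

Lemma oreY_comm (i j : 'I_n) : oreY i * oreY j = oreY j * oreY i.
Proof.
have E k l : oreY k * oreY l = omon D 1 (U_(k) + U_(l))%MM.
  rewrite [LHS]omulX scale1r -{1}[U_(k)%MM]addm0 tlmulS tlmul0 ylmulX.
  by rewrite rmorph1 odelta1 {2}/omon scale0r addr0.
by rewrite !E addmC.
Qed.

(* The defining relation of the i-th extension step, for an arbitrary element *)
(* p, with alpha_i and delta_i extended coefficientwise.                      *)
Lemma oreY_mul (i : 'I_n) (p : ore D) :
  oreY i * p = (\sum_(t <- msupp p) omon D (oalpha D i p@_t) t) * oreY i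
             + \sum_(t <- msupp p) omon D (odelta D i p@_t) t.
Proof.
rewrite [LHS]omulX scale1r -{1}[U_(i)%MM]addm0 tlmulS tlmul0 mulr_suml.
rewrite -big_split /=; apply: eq_bigr => t _; congr (_ + _).
by rewrite [RHS]omulX /oreY -tlmulX -tlmulD tlmulX addmC omonZ mulr1.
Qed.

End OreTheory.

Section Graded.
Variables (R : nzRingType) (n : nat) (D : ore_data R n).

Definition delta0 (i : 'I_n) : {additive R -> R} := \0.

Lemma graded_deltaM i r s :
  delta0 i (r * s) = oalpha D i r * delta0 i s + delta0 i r * s.
Proof. by rewrite /= mulr0 mul0r addr0. Qed.

Lemma graded_alpha_deltaC i j : i != j ->
  forall r, oalpha D j (delta0 i r) = delta0 i (oalpha D j r).
Proof. by move=> _ r; rewrite /= rmorph0. Qed.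

(* ore graded is the associated graded extension R[Y_1;alpha_1]...[Y_n;alpha_n]; *)
(* it shares its carrier and left R-module structure with ore D.              *)
Definition graded : ore_data R n :=
  @OreData R n (oalpha D) delta0 (@oalpha_inj _ _ D) graded_deltaM
    (@oalphaC _ _ D) (fun _ _ _ => erefl) graded_alpha_deltaC.

Definition talpha (t : 'X_{1..n}) (r : R) : R :=
  foldr (fun i => iter (t i) (oalpha D i)) r (enum 'I_n).

Lemma graded_mul a b s t :
  omon graded a s * omon graded b t
  = omon graded (a * talpha s b) (s + t)%MM.
Proof.
rewrite [LHS]omulX /tlmul /talpha.
have iterE k i c w : iter k (ylmul i) (omon graded c w) =
    omon graded (iter k (oalpha D i) c) (w + U_(i) *+ k)%MM.
  elim: k => [|k IHk]; first by rewrite mulm0n addm0.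
  rewrite !iterS IHk ylmulX {2}/omon scale0r addr0; congr omon.
  by rewrite mulmS addmA (addmC U_(i)%MM w) -addmA.
have -> (e : seq 'I_n) : foldr (fun i => iter (s i) (ylmul i)) (omon graded b t) e
    = omon graded (foldr (fun i => iter (s i) (oalpha D i)) b e)
        (t + \big[+%MM/0%MM]_(i <- e) (U_(i) *+ s i)%MM)%MM.
  elim: e => [|i e IHe]; first by rewrite big_nil addm0.
  by rewrite /= IHe iterE big_cons -addmA (addmC (_ *+ _)%MM).
by rewrite /omon scalerA big_enum -multinomUE_id addmC.
Qed.

End Graded.

Record well_order (T : eqType) (lt : rel T) : Prop := WellOrder {
  wo_irr : irreflexive lt;
  wo_trans : transitive lt;
  wo_total : forall x y, x != y -> lt x y || lt y x;
  wo_wf : well_founded (fun x y => lt x y)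
}.

(* (t, i) : 'X_{1..n} * 'I_m stands for the term t e_i. *)
Definition tact n m (s : 'X_{1..n}) (x : 'X_{1..n} * 'I_m) := ((s + x.1)%MM, x.2).

Definition term_order n (ltT : rel 'X_{1..n}) : Prop :=
  well_order ltT /\ forall s t1 t2, ltT t1 t2 -> ltT (s + t1)%MM (s + t2)%MM.

Definition compatible_order n m (ltT : rel 'X_{1..n})
    (ltM : rel ('X_{1..n} * 'I_m)) : Prop :=
  [/\ well_order ltM,
      forall s1 s2 x, ltT s1 s2 -> ltM (tact s1 x) (tact s2 x)
    & forall s x1 x2, ltM x1 x2 -> ltM (tact s x1) (tact s x2)].

Definition omax (T : Type) (lt : rel T) (s : seq T) : option T :=
  foldr (fun x acc => if acc is Some y then Some (if lt x y then y else x)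
                      else Some x) None s.

Definition lspan (A : nzRingType) (V : lmodType A) (X : V -> Prop) (v : V) : Prop :=
  exists s : seq (A * V),
    (forall x, x \in s -> X x.2) /\ v = \sum_(x <- s) x.1 *: x.2.

Section Syzygies.
Variables (R : nzRingType) (n m u : nat) (D : ore_data R n).
Variables (ltT : rel 'X_{1..n}) (ltM : rel ('X_{1..n} * 'I_m)).

Notation OR := (ore D).
Notation OS := (ore (graded D)).

(* lead_term 0 is the dummy 0%MM; then lead_mon 0 = 0. *)
Definition lead_term (h : OR) : 'X_{1..n} := odflt 0%MM (omax ltT (msupp h)).
Definition lead_mon (h : OR) : OS :=
  omon (graded D) h@_(lead_term h) (lead_term h).

(* Is None exactly when f = 0. *)
Definition vlead_term (f : 'rV[OR]_m) : option ('X_{1..n} * 'I_m) :=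
  omax ltM [seq (t, i) | i <- enum 'I_m, t <- msupp (f 0 i)].
Definition vlead_coef (f : 'rV[OR]_m) : R :=
  if vlead_term f is Some x then (f 0 x.2)@_(x.1) else 0.
Definition vlead_mon (f : 'rV[OR]_m) : 'rV[OS]_m :=
  if vlead_term f is Some x
  then omon (graded D) (vlead_coef f) x.1 *: delta_mx 0 x.2 else 0.

Variable g : 'I_u -> 'rV[OR]_m.

Definition left_groebner : Prop :=
  forall f, lspan (fun x => exists i, x = g i) f -> f != 0 ->
  exists s : seq (R * 'X_{1..n} * 'I_u),
    (forall a lam j, (a, lam, j) \in s ->
       a != 0 /\ omap (tact lam) (vlead_term (g j)) = vlead_term f) /\
    vlead_mon f =
      \sum_(x <- s) omon (graded D) x.1.1 x.1.2 *: vlead_mon (g x.2).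

Definition syz_lead (h : 'rV[OS]_u) : 'rV[OS]_m :=
  \sum_(i < u) h 0 i *: vlead_mon (g i).
Definition syz (h : 'rV[OR]_u) : 'rV[OR]_m := \sum_(i < u) h 0 i *: g i.

Definition syz_term (h : 'rV[OR]_u) (i : 'I_u) : option ('X_{1..n} * 'I_m) :=
  omap (tact (lead_term (h 0 i))) (vlead_term (g i)).
(* The maximum v(h) of the terms T(h_i) o T(g_i), h_i != 0. *)
Definition syz_deg (h : 'rV[OR]_u) : option ('X_{1..n} * 'I_m) :=
  omax ltM (pmap (syz_term h) [seq i <- enum 'I_u | h 0 i != 0]).
Definition lead_form (h : 'rV[OR]_u) : 'rV[OS]_u :=
  \sum_(i < u | (h 0 i != 0) && (syz_term h i == syz_deg h))
     lead_mon (h 0 i) *: delta_mx 0 i.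

Definition homogeneous (sigma : 'rV[OS]_u) : Prop :=
  sigma != 0 /\
  exists (a : 'I_u -> R) (lam : 'I_u -> 'X_{1..n}),
    sigma = \sum_(i < u) omon (graded D) (a i) (lam i) *: delta_mx 0 i /\
    exists w, forall i, a i != 0 ->
      omap (tact (lam i)) (vlead_term (g i)) = Some w.

Definition gebauer_moller (GM : 'rV[OS]_u -> Prop) : Prop :=
  (forall sigma, GM sigma -> homogeneous sigma) /\
  (forall sigma, lspan GM sigma <-> syz_lead sigma = 0).

Definition lifting (sigma : 'rV[OS]_u) (U : 'rV[OR]_u) : Prop :=
  syz U = 0 /\ lead_form U = sigma.

Definition lead_forms (N : 'rV[OR]_u -> Prop) (x : 'rV[OS]_u) : Prop :=
  exists h, [/\ N h, h != 0 & x = lead_form h].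

Definition standard_basis (N B : 'rV[OR]_u -> Prop) : Prop :=
  (forall b, B b -> N b) /\
  (forall x, lspan (lead_forms B) x <-> lspan (lead_forms N) x).

End Syzygies.

(* Main.v *)
(* The product of terms in the Ore extension differs from that of its graded  *)
(* companion only by strictly smaller terms.  A homogeneous sigma in          *)
(* ker s_L of degree w, read in R^u, therefore has S_L(sigma) with all terms  *)
(* below w; since F is a Groebner basis, S_L(sigma) = sum h_i g_i with        *)
(* T(h_i) o T(g_i) < w, by well-founded induction on the leading term, and    *)
(* sigma - h is a lifting.  Conversely, comparing coefficients at v(h), the   *)
(* leading form of any h in ker S_L lies in ker s_L, which is spanned by GM,  *)
(* i.e. by the leading forms of the liftings.                                 *)
From HB Require Import structures.
Require Import Defs.
From mathcomp Require Import all_boot all_order all_algebra.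

Set Implicit Arguments.
Unset Strict Implicit.
Unset Printing Implicit Defensive.

Import GRing.Theory.
Local Open Scope ring_scope.

(** Multiplication by a term in the Ore extension and in its graded companion produce the same top
    coefficient, because $\delta_i$ contributes only to terms that are not raised by $Y_i$. The
    predicate [dominated] records an upper bound for the terms together with the coefficient at that
    bound; [dominated_omon] and [dominated_scale] show that it is multiplicative exactly as in the
    graded product. Summing over the generators, [dominated_syz] identifies the coefficient of
    $\mathfrak S_L(h)$ at a bound $w$ with that of $\mathfrak s_L$ on the degree-$w$ part of $h$.
    For $h$ in $\ker\mathfrak S_L$ and $w=v(h)$ this gives [lead_form_ker]. For homogeneous $\sigma$
    in $\ker\mathfrak s_L$ it puts $\mathfrak S_L(\sigma)$ strictly below $w$;
    [groebner_representation] rewrites that element using lower terms only, whence [lifting_exists].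
    Leading forms of the kernel thus lie in $\ker\mathfrak s_L$, which is spanned by the given
    $\sigma$, themselves the leading forms of their liftings. *)

(** * Maxima of finite sequences under a well-order *)

Section WellOrder.
Variables (T : eqType) (lt : rel T).
Hypothesis lt_wo : well_order lt.

Lemma wo_asym x y : lt x y -> ~~ lt y x.
Proof.
move=> xy; apply/negP => yx.
by have := wo_trans lt_wo xy yx; rewrite (wo_irr lt_wo).
Qed.

Lemma wo_lt_neq x y : lt x y -> x != y.
Proof. by apply: contraTneq => ->; rewrite (wo_irr lt_wo). Qed.

Lemma omax_None (s : seq T) : (omax lt s == None) = (s == [::]).
Proof. by case: s => //= a s; case: (omax _ _). Qed.

Lemma omaxP (s : seq T) x :
  omax lt s = Some x <-> x \in s /\ forall y, y \in s -> ~~ lt x y.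
Proof.
have max_ge s' z : omax lt s' = Some z ->
    z \in s' /\ forall y, y \in s' -> ~~ lt z y.
  elim: s' z => //= a e IHe z.
  case E: (omax lt e) IHe => [b|] IHe; last first.
    move/eqP: E; rewrite omax_None => /eqP-> [<-]; split; first exact: mem_head.
    by move=> y; rewrite mem_seq1 => /eqP->; rewrite (wo_irr lt_wo).
  have [be ub] := IHe b erefl; case=> <-; case: ifP => ab; split.
  - by rewrite inE be orbT.
  - by move=> y; rewrite inE => /orP[/eqP-> | /ub//]; exact: wo_asym.
  - exact: mem_head.
  - move=> y; rewrite inE => /orP[/eqP->| ye]; first by rewrite (wo_irr lt_wo).
    apply/negP => ay; have [eby|nby] := eqVneq b y.
      by rewrite eby ay in ab.
    have /orP[by_|yb] := wo_total lt_wo nby.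
      by move: (ub _ ye); rewrite by_.
    by rewrite (wo_trans lt_wo ay yb) in ab.
split; first exact: max_ge.
case: (omax lt s) (max_ge s) (omax_None s) => [z /(_ z erefl) [zs zub] _|_].
  case=> xs xub; have [->//|nxz] := eqVneq z x.
  by have := wo_total lt_wo nxz; rewrite (negPf (xub z zs)) (negPf (zub x xs)).
by rewrite eqxx; case: {max_ge} s => //= _ [].
Qed.

End WellOrder.

(** * Coefficient functionals *)

Section Coefficients.
Variables (R : nzRingType) (n m : nat) (D : ore_data R n).
Local Notation term := ('X_{1..n} * 'I_m)%type.

(** Retyped on [ore D], so that it can be declared additive for the structure carrying the Ore
    product. *)
Definition ocoef (t : 'X_{1..n}) (p : ore D) : R := p@_t.

Lemma ocoefB t : zmod_morphism (ocoef t).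
Proof. by move=> p q; exact: mcoeffB. Qed.

HB.instance Definition _ t :=
  GRing.isZmodMorphism.Build (ore D) R (ocoef t) (ocoefB t).

Lemma ocoefZ t a p : ocoef t (a *: p) = a * ocoef t p.
Proof. exact: mcoeffZ. Qed.

Lemma ocoef_omon t a s : ocoef t (omon D a s) = a *+ (s == t).
Proof. by rewrite ocoefZ /ocoef mcoeffX mulr_natr. Qed.

Lemma ocoef_eq0 p : (forall t, ocoef t p = 0) -> p = 0.
Proof. by move=> p0; apply/mpolyP => t; rewrite [LHS]p0 mcoeff0. Qed.

Lemma mem_supp (p : ore D) t : (t \in msupp p) = (ocoef t p != 0).
Proof. by rewrite mcoeff_msupp. Qed.

Definition vcoef (x : term) (f : 'rV[ore D]_m) : R := ocoef x.1 (f 0 x.2).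

Lemma vcoefB x : zmod_morphism (vcoef x).
Proof. by move=> f k; rewrite /vcoef !mxE raddfB. Qed.

HB.instance Definition _ x :=
  GRing.isZmodMorphism.Build 'rV[ore D]_m R (vcoef x) (vcoefB x).

Lemma vcoef_eq0 f : (forall x, vcoef x f = 0) -> f = 0.
Proof.
move=> f0; apply/rowP => i; rewrite mxE.
by apply: ocoef_eq0 => t; exact: (f0 (t, i)).
Qed.

Lemma vcoefZ x p f : vcoef x (p *: f) = ocoef x.1 (p * f 0 x.2).
Proof. by rewrite /vcoef mxE. Qed.

(** The only place where $\delta_i$ is computed: it acts without shifting the term, while the
    $\alpha_i$ part comes from the term one factor $Y_i$ below. *)
Lemma ocoef_ylmul i t q :
  ocoef t (ylmul i q)
  = (if (U_(i) <= t)%MM then oalpha D i (ocoef (t - U_(i)) q) else 0)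
    + odelta D i (ocoef t q).
Proof.
rewrite (oreE q); elim/big_ind: _ => [|p r IHp IHr|s _].
- by rewrite !raddf0 if_same addr0.
- rewrite !raddfD /= IHp IHr; case: ifP => _; last by rewrite !add0r.
  by rewrite addrACA.
rewrite ylmulX raddfD /= !ocoef_omon !raddfMn /=; congr (_ + _).
case: ifP => [le_it|nle]; last first.
  by case: eqP => // Et; rewrite -Et lem_addr in nle.
by rewrite -{1}(submK le_it) [(_ - _ + _)%MM]addmC eqm_add2l.
Qed.

End Coefficients.

Lemma tactA n m (s t : 'X_{1..n}) (x : 'X_{1..n} * 'I_m) :
  tact (s + t)%MM x = tact s (tact t x).
Proof. by rewrite /tact /= addmA. Qed.

Lemma tact0 n m (x : 'X_{1..n} * 'I_m) : tact 0%MM x = x.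
Proof. by case: x => t i; rewrite /tact add0m. Qed.

(** Since $\tau\ast a=\alpha_\tau(a)\tau$ in the graded extension, the recursion for [tlmul]
    transfers to [talpha] by reading off a coefficient. *)
Lemma talphaS (R : nzRingType) n (D : ore_data R n) i (s : 'X_{1..n}) a :
  talpha D (U_(i) + s)%MM a = oalpha D i (talpha D s a).
Proof.
have E t : tlmul t (omon (graded D) a 0%MM) = omon (graded D) (talpha D t a) t.
  by have := graded_mul D 1 a t 0%MM; rewrite [LHS]omulX scale1r mul1r addm0.
have := E (U_(i) + s)%MM; rewrite tlmulS E ylmulX /= {2}/omon scale0r addr0.
by move/(congr1 (ocoef (U_(i) + s)%MM)); rewrite !ocoef_omon eqxx.
Qed.

Lemma talpha0 (R : nzRingType) n (D : ore_data R n) a : talpha D 0%MM a = a.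
Proof. by rewrite /talpha; elim: (enum _) => //= i e ->; rewrite mnm0E. Qed.

(** * Leading terms and their behaviour under multiplication *)

Section Leading.
Variables (R : nzRingType) (n m : nat) (D : ore_data R n).
Variables (ltT : rel 'X_{1..n}) (ltM : rel ('X_{1..n} * 'I_m)).
Hypothesis ltT_term : term_order ltT.
Hypothesis ltM_compat : compatible_order ltT ltM.
Local Notation term := ('X_{1..n} * 'I_m)%type.
Implicit Types (f k : 'rV[ore D]_m) (p : ore D) (x y w : term).

Let ltT_wo : well_order ltT := proj1 ltT_term.
Let ltM_wo : well_order ltM. Proof. by case: ltM_compat. Qed.

Lemma lt_tact s x y : ltM (tact s x) (tact s y) = ltM x y.
Proof.
have [_ _ mono] := ltM_compat; apply/idP/idP => [|/mono//].
have [->|nxy] := eqVneq x y; first by rewrite !(wo_irr ltM_wo).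
have /orP[//|/(mono s) yx] := wo_total ltM_wo nxy.
by move/(wo_trans ltM_wo yx); rewrite (wo_irr ltM_wo).
Qed.

Lemma tact_lt s t x : ltM (tact s x) (tact t x) = ltT s t.
Proof.
have [_ mono _] := ltM_compat; apply/idP/idP => [|/mono//].
have [->|nst] := eqVneq s t; first by rewrite !(wo_irr ltM_wo).
have /orP[//|ts] := wo_total ltT_wo nst.
by move/(wo_trans ltM_wo (mono _ _ x ts)); rewrite (wo_irr ltM_wo).
Qed.

(** If $Y_iy<y$, then $Y_i(Y_iy)<Y_iy$, and so on: an infinite descent, excluded by
    well-foundedness. Equality is excluded by the exponent of $Y_i$. *)
Lemma lt_U i x : ltM x (tact U_(i)%MM x).
Proof.
have nlt y : ~~ ltM (tact U_(i)%MM y) y.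
  elim/(well_founded_ind (wo_wf ltM_wo)): y => y IHy; apply/negP => lt_y.
  by have := IHy _ lt_y; rewrite lt_tact lt_y.
have : x != tact U_(i)%MM x.
  case: x => t j; rewrite /tact xpair_eqE eqxx andbT -[X in X == _]add0m.
  by rewrite eqm_add2r; apply/eqP => /mnmP/(_ i); rewrite mnm1E mnm0E eqxx.
by move=> /(wo_total ltM_wo)/orP[//|]; rewrite (negPf (nlt x)).
Qed.

(* x may exceed the maximal term of f; then c = 0. *)
Definition dominated f x (c : R) : Prop :=
  vcoef x f = c /\ forall y, ltM x y -> vcoef y f = 0.

Lemma dominatedD f k x c d :
  dominated f x c -> dominated k x d -> dominated (f + k) x (c + d).
Proof.
by move=> [<- f0] [<- k0]; split=> [|y xy];
  rewrite raddfD //= f0 // k0 // addr0.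
Qed.

Lemma dominatedB f k x c d :
  dominated f x c -> dominated k x d -> dominated (f - k) x (c - d).
Proof.
by move=> [<- f0] [<- k0]; split=> [|y xy];
  rewrite raddfB //= f0 // k0 // subr0.
Qed.

Lemma dominated0 x : dominated 0 x 0.
Proof. by split=> *; rewrite raddf0. Qed.

Lemma dominated_sum (I : eqType) (e : seq I) (P : pred I)
    (F : I -> 'rV[ore D]_m) (c : I -> R) x :
  (forall i, i \in e -> P i -> dominated (F i) x (c i)) ->
  dominated (\sum_(i <- e | P i) F i) x (\sum_(i <- e | P i) c i).
Proof.
move=> dF; rewrite big_seq_cond [X in dominated _ _ X]big_seq_cond.
elim/big_ind2: _ => [|f1 c1 f2 c2|i]; [exact: dominated0|exact: dominatedD|].
by move=> /andP[]; exact: dF.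
Qed.

Lemma dominated_lt f x y c : dominated f x c -> ltM x y -> dominated f y 0.
Proof.
move=> [_ f0] xy; split=> [|z yz]; first exact: f0.
by apply: f0; exact: (wo_trans ltM_wo xy yz).
Qed.

Lemma dominatedZ a f x c :
  dominated f x c -> dominated ((a *: 1 : ore D) *: f) x (a * c).
Proof.
have E y : vcoef y ((a *: 1 : ore D) *: f) = a * vcoef y f.
  by rewrite vcoefZ -scalerAl mul1r ocoefZ.
by move=> [<- f0]; split=> [|y xy]; rewrite E // f0 // mulr0.
Qed.

Lemma vcoef_Y i f y :
  vcoef y (oreY D i *: f) = ocoef y.1 (ylmul i (f 0 y.2)).
Proof.
rewrite vcoefZ; congr ocoef.
by rewrite [LHS]omulX scale1r -[U_(i)%MM]addm0 tlmulS tlmul0.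
Qed.

(** At $Y_ix$ and above, the derivation sees only coefficients of $f$ at terms greater than $x$,
    which vanish; only the twisted shift remains. *)
Lemma dominated_Y i f x c :
  dominated f x c -> dominated (oreY D i *: f) (tact U_(i)%MM x) (oalpha D i c).
Proof.
move=> [<- f0]; split=> [|y lt_y]; rewrite vcoef_Y ocoef_ylmul.
  have -> : ((tact U_(i) x).1 - U_(i) = x.1)%MM by rewrite /tact /= addmC addmK.
  rewrite lem_addr -[ocoef (_ + _)%MM _]/(vcoef (tact U_(i)%MM x) f).
  by rewrite f0 ?lt_U // raddf0 addr0.
rewrite -/(vcoef y f) f0 ?raddf0 ?addr0; last first.
  exact: (wo_trans ltM_wo (lt_U i x) lt_y).
case: ifP => // le_iy; have Ey : y = tact U_(i)%MM ((y.1 - U_(i))%MM, y.2).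
  by case: y {lt_y} le_iy => t j /= le_it; rewrite /tact /= addmC submK.
rewrite -[ocoef _ _]/(vcoef ((y.1 - U_(i))%MM, y.2) f) f0 ?raddf0 //.
by rewrite -(lt_tact U_(i)%MM) -Ey.
Qed.

Lemma dominated_omon a s f x c :
  dominated f x c ->
  dominated (omon D a s *: f) (tact s x) (a * talpha D s c).
Proof.
have -> : omon D a s *: f = (a *: 1 : ore D) *: (omon D 1 s *: f).
  by rewrite scalerA -scalerAl mul1r omonZ mulr1.
move=> f_x; apply: dominatedZ; elim/mnm_ind: s => [|i s IHs].
  by rewrite talpha0 tact0 -[omon D 1 0%MM]/(1 : ore D) scale1r.
have -> : omon D 1 (U_(i) + s)%MM = oreY D i * omon D 1 s.
  rewrite [RHS]omulX scale1r -[X in _ = tlmul X _]addm0 tlmulS tlmul0 ylmulX.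
  by rewrite rmorph1 odelta1 [omon D 0 _]scale0r addr0.
by rewrite -scalerA talphaS tactA; exact: dominated_Y.
Qed.

(** Terms of $p$ other than $s$ are smaller than $s$, so their products with $f$ stay strictly below
    $s\circ x$. *)
Lemma dominated_scale p s f x c :
  (forall t, ltT s t -> ocoef t p = 0) -> dominated f x c ->
  dominated (p *: f) (tact s x) (ocoef s p * talpha D s c).
Proof.
move=> p_s f_x; rewrite {1}(oreE p) scaler_suml.
(* The term $s$ need not occur in $p$; in that case both sides are zero. *)
have -> : ocoef s p * talpha D s c =
    \sum_(t <- msupp p) (if t == s then p@_t * talpha D t c else 0).
  rewrite -big_mkcond /=.
  have [s_p|] := boolP (s \in msupp p).
    rewrite (big_rem s s_p) /= eqxx [X in _ + X]big_seq_cond.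
    rewrite big1 ?addr0 // => t.
    by rewrite mem_rem_uniq ?msupp_uniq // !inE; case: (t == s); rewrite ?andbF.
  rewrite (mem_supp p) negbK => /eqP p0; rewrite p0 mul0r big1 // => t /eqP->.
  by rewrite [p@_s]p0 mul0r.
apply: dominated_sum => t t_p _.
have t_pn0 : ocoef t p != 0 by rewrite -(mem_supp p).
have dt := dominated_omon p@_t t f_x.
have [<-//|nts] := eqVneq t s.
apply: dominated_lt dt _; rewrite tact_lt.
have /orP[//|st] := wo_total ltT_wo nts.
by rewrite p_s ?eqxx in t_pn0.
Qed.

Lemma lead_termP p s : p != 0 ->
  lead_term ltT p = s <->
  ocoef s p != 0 /\ forall t, ltT s t -> ocoef t p = 0.
Proof.
move=> p_n0; have omax_s : lead_term ltT p = s <-> omax ltT (msupp p) = Some s.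
  rewrite /lead_term; case E: (omax _ _) => [t|] /=; first by split=> [->|[]].
  by move/eqP: E; rewrite omax_None msupp_eq0 (negPf p_n0).
rewrite omax_s (omaxP ltT_wo) (mem_supp p); split=> -[s_p s_max]; split=> // t.
  move=> lt_st; apply/eqP; apply: contraTT lt_st => t_p.
  by apply: s_max; rewrite (mem_supp p).
by rewrite (mem_supp p); apply: contraNN => /s_max ->.
Qed.

Lemma mem_vterms f y :
  (y \in [seq (t, i) | i <- enum 'I_m, t <- msupp (f 0 i)]) = (vcoef y f != 0).
Proof.
apply/allpairsPdep/idP => [[i [t [_ t_f ->]]]|y_f].
  by rewrite -(mem_supp (f 0 i)).
exists y.2, y.1; rewrite mem_enum; split=> //; last by case: (y).
by rewrite (mem_supp (f 0 _)).
Qed.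

Lemma vlead_termP f x :
  vlead_term ltM f = Some x <->
  vcoef x f != 0 /\ forall y, ltM x y -> vcoef y f = 0.
Proof.
rewrite /vlead_term (omaxP ltM_wo) mem_vterms.
split=> -[x_f x_max]; split=> // y.
  move=> lt_xy; apply/eqP; apply: contraTT lt_xy => y_f.
  by apply: x_max; rewrite mem_vterms.
by rewrite mem_vterms; apply: contraNN => /x_max ->.
Qed.

Lemma vlead_term_ex f : f != 0 -> exists x, vlead_term ltM f = Some x.
Proof.
move=> f_n0; case E: (vlead_term ltM f) => [x|]; first by exists x.
case/eqP: f_n0; apply: vcoef_eq0 => -[t i]; apply/eqP; rewrite -[_ == 0]negbK.
by rewrite -mem_vterms; move/eqP: E; rewrite omax_None => /eqP->.
Qed.

(** Turns a cancellation at the bound into a strict drop of the leading term. *)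
Lemma vlead_term_lt f w : f != 0 -> dominated f w 0 ->
  exists2 x, vlead_term ltM f = Some x & ltM x w.
Proof.
move=> f_n0 [f_w f_max]; have [x f_x] := vlead_term_ex f_n0; exists x => //.
have [x_n0 _] := (vlead_termP _ _).1 f_x.
have [Ex|/(wo_total ltM_wo)/orP[//|/f_max Ex]] := eqVneq x w.
  by rewrite Ex f_w eqxx in x_n0.
by rewrite Ex eqxx in x_n0.
Qed.

Definition vmon x (a : R) : 'rV[ore (graded D)]_m :=
  omon (graded D) a x.1 *: delta_mx 0 x.2.

Lemma vmonB x : zmod_morphism (vmon x).
Proof. by move=> a b; rewrite /vmon /omon !scalerBl. Qed.

HB.instance Definition _ x :=
  GRing.isZmodMorphism.Build R _ (vmon x) (vmonB x).

Lemma scale_vmon a s c x :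
  omon (graded D) a s *: vmon x c = vmon (tact s x) (a * talpha D s c).
Proof. by rewrite /vmon scalerA graded_mul. Qed.

(** Used to read identities between monomials of $\mathsf S^m$ as identities of coefficients in
    $R$. *)
Lemma vmon_inj x : injective (vmon x).
Proof.
move=> a b /(congr1 (fun f : 'rV_m => ocoef x.1 (f 0 x.2))).
by rewrite /= !mxE !eqxx !mulr1 !ocoef_omon eqxx.
Qed.

Lemma vlead_monE f x :
  vlead_term ltM f = Some x -> vlead_mon ltM f = vmon x (vcoef x f).
Proof. by rewrite /vlead_mon /vlead_coef => ->. Qed.

End Leading.

(** * Linear combinations and spans *)

Section RowComb.
Variables (A : nzRingType) (V : lmodType A) (u : nat) (G : 'I_u -> V).

(** Common form of [syz] and [syz_lead], which are convertible to it and inherit its linearity. *)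
Definition rowcomb (h : 'rV[A]_u) : V := \sum_(i < u) h 0 i *: G i.

Lemma rowcomb_is_linear : linear rowcomb.
Proof.
move=> a h k; rewrite /rowcomb scaler_sumr -big_split /=.
by apply: eq_bigr => i _; rewrite !mxE scalerDl scalerA.
Qed.

HB.instance Definition _ :=
  GRing.isLinear.Build A 'rV[A]_u V _ rowcomb rowcomb_is_linear.

Lemma rowcomb_delta p i : rowcomb (p *: delta_mx 0 i) = p *: G i.
Proof.
rewrite linearZ /=; congr (_ *: _); rewrite /rowcomb (bigD1 i) //= big1 ?addr0.
  by rewrite mxE !eqxx scale1r.
by move=> j /negPf nji; rewrite mxE nji andbF scale0r.
Qed.

Lemma lspan_rowcomb h : lspan (fun x => exists i, x = G i) (rowcomb h).
Proof.
exists [seq (h 0 i, G i) | i <- enum 'I_u]; split.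
  by move=> x /mapP[i _ ->]; exists i.
by rewrite big_map big_enum.
Qed.

End RowComb.

Lemma lspan_sub (A : nzRingType) (V : lmodType A) (X Y : V -> Prop) v :
  (forall x, X x -> Y x) -> lspan X v -> lspan Y v.
Proof. by move=> XY [s [sX ->]]; exists s; split=> // x /sX /XY. Qed.

Lemma lspan_mem (A : nzRingType) (V : lmodType A) (X : V -> Prop) v :
  X v -> lspan X v.
Proof.
move=> Xv; exists [:: (1, v)]; rewrite big_seq1 scale1r; split=> // x.
by rewrite mem_seq1 => /eqP->.
Qed.

Lemma lspan_ker (A : nzRingType) (V W : lmodType A) (f : {linear V -> W})
    (X : V -> Prop) v :
  (forall x, X x -> f x = 0) -> lspan X v -> f v = 0.
Proof.
move=> f0 [s [sX ->]]; rewrite raddf_sum big_seq big1 // => x /sX /f0 fx.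
by rewrite [LHS](linearZ_LR f) fx scaler0.
Qed.

(** * Liftings of homogeneous syzygies and leading forms of syzygies *)

Section Lifting.
Variables (R : nzRingType) (n m u : nat) (D : ore_data R n).
Variables (ltT : rel 'X_{1..n}) (ltM : rel ('X_{1..n} * 'I_m)).
Hypothesis ltT_term : term_order ltT.
Hypothesis ltM_compat : compatible_order ltT ltM.
Variables (g : 'I_u -> 'rV[ore D]_m) (gt : 'I_u -> 'X_{1..n} * 'I_m).
Hypothesis gtE : forall i, vlead_term ltM (g i) = Some (gt i).
Implicit Types (h U : 'rV[ore D]_u) (w : 'X_{1..n} * 'I_m).

Let ltT_wo : well_order ltT := proj1 ltT_term.
Let ltM_wo : well_order ltM. Proof. by case: ltM_compat. Qed.
Local Notation glc i := (vcoef (gt i) (g i)).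

Lemma dominated_g i : dominated ltM (g i) (gt i) (glc i).
Proof. by have /(vlead_termP ltM_compat)[_ ?] := gtE i. Qed.

Lemma syz_termE h i :
  syz_term ltT ltM g h i = Some (tact (lead_term ltT (h 0 i)) (gt i)).
Proof. by rewrite /syz_term gtE. Qed.

Lemma vlead_mon_g i : vlead_mon ltM (g i) = vmon D (gt i) (glc i).
Proof. exact: vlead_monE. Qed.

Lemma dominated_syz h (s : 'I_u -> 'X_{1..n}) (P : pred 'I_u) w :
  (forall i, P i -> tact (s i) (gt i) = w) ->
  (forall i t, P i -> ltT (s i) t -> ocoef t (h 0 i) = 0) ->
  (forall i, ~~ P i -> dominated ltM (h 0 i *: g i) w 0) ->
  dominated ltM (syz g h) w
    (\sum_(i | P i) ocoef (s i) (h 0 i) * talpha D (s i) (glc i)).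
Proof.
move=> sw s_max notP; rewrite big_mkcond; apply: dominated_sum => i _ _.
case: ifPn => [Pi|/notP//]; rewrite -(sw i Pi).
apply: (dominated_scale ltT_term ltM_compat) (dominated_g i) => t.
exact: s_max.
Qed.

(* T(h_i) o T(g_i) <= w for every i. *)
Definition syz_le h w :=
  forall i t, ltM w (tact t (gt i)) -> ocoef t (h 0 i) = 0.

(** One step of division cancels the coefficient at $w$; the remainder is again of the form
    $\mathfrak S_L(k')$ with a smaller leading term, so well-founded induction applies. *)
Lemma groebner_representation (G : left_groebner ltM g) w k :
  vlead_term ltM (syz g k) = Some w ->
  exists h, syz g h = syz g k /\ syz_le h w.
Proof.
elim/(well_founded_ind (wo_wf ltM_wo)): w k => w IHw k k_w.
have [k_n0 k_max] := (vlead_termP ltM_compat _ _).1 k_w.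
have [||s [sw sum_s]] := G (syz g k).
- exact: (lspan_rowcomb g k).
- by apply: contraNneq k_n0 => ->; rewrite raddf0.
(* The graded combination giving $\mathbf M(f)$, $f=\mathfrak S_L(k)$, is read in $\mathsf R^u$;
   evaluated with $\star$ it agrees with $f$ at $w$ and has no terms above $w$. *)
pose h0 : 'rV[ore D]_u := \sum_(x <- s) omon D x.1.1 x.1.2 *: delta_mx 0 x.2.
have tact_s x : x \in s -> tact x.1.2 (gt x.2) = w.
  case: x => -[a lam] j /sw[_]; rewrite gtE k_w.
  by case.
have h0_w : syz_le h0 w.
  move=> i t lt_w; rewrite summxE raddf_sum big_seq big1 // => x /tact_s x_w.
  rewrite !mxE /=; case: eqP => [Ei|_]; last by rewrite mulr0 raddf0.
  rewrite mulr1 ocoef_omon; case: eqP => // Et.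
  by rewrite Ei -Et x_w (wo_irr ltM_wo) in lt_w.
have syz_h0 : dominated ltM (syz g h0) w (vcoef w (syz g k)).
  have -> : syz g h0 = \sum_(x <- s) omon D x.1.1 x.1.2 *: g x.2.
    rewrite -[syz g h0]/(rowcomb g h0) raddf_sum; apply: eq_bigr => x _.
    exact: rowcomb_delta.
  have -> : vcoef w (syz g k)
      = \sum_(x <- s) x.1.1 * talpha D x.1.2 (glc x.2).
    apply: (@vmon_inj _ _ _ D w); rewrite -(vlead_monE k_w) sum_s raddf_sum.
    rewrite big_seq [RHS]big_seq; apply: eq_bigr => x /tact_s x_w.
    by rewrite vlead_mon_g scale_vmon x_w.
  apply: dominated_sum => x /tact_s x_w _; rewrite -x_w.
  exact: (dominated_omon ltM_compat _ _ (dominated_g _)).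
have syzB : syz g (k - h0) = syz g k - syz g h0 := raddfB (rowcomb g) k h0.
have syzD h h' : syz g (h + h') = syz g h + syz g h' := raddfD (rowcomb g) h h'.
have d_w : dominated ltM (syz g (k - h0)) w 0.
  by rewrite syzB -(subrr (vcoef w (syz g k))); apply: dominatedB.
have [d0|d_n0] := eqVneq (syz g (k - h0)) 0.
  by exists h0; split=> //; apply/esym/eqP; rewrite -subr_eq0 -syzB d0.
have [w1 w1E lt_w1] := vlead_term_lt ltM_compat d_n0 d_w.
have [h1 [h1E h1_w1]] := IHw w1 lt_w1 _ w1E.
exists (h0 + h1); split; first by rewrite syzD h1E syzB addrC subrK.
move=> i t lt_w; rewrite mxE raddfD /= h0_w // h1_w1 ?addr0 //.
exact: (wo_trans ltM_wo lt_w1 lt_w).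
Qed.

Lemma lifting_exists (G : left_groebner ltM g) sigma :
  homogeneous ltM g sigma -> syz_lead ltM g sigma = 0 ->
  exists U, lifting ltT ltM g sigma U.
Proof.
move=> [sigma_n0 [a [lam [sigmaE [w w_lam]]]]] sigma_ker.
have lam_w i : a i != 0 -> tact (lam i) (gt i) = w.
  by move/w_lam; rewrite gtE => -[].
(* This is $\sigma$ itself, read in $\mathsf R^u$. *)
pose k : 'rV[ore D]_u := \row_i omon D (a i) (lam i).
have k_w : dominated ltM (syz g k) w 0.
  (* The coefficient at $w$ is that of $\mathfrak s_L(\sigma)$, which is zero. *)
  have <- : \sum_(i | a i != 0) ocoef (lam i) (k 0 i) * talpha D (lam i) (glc i)
      = 0.
    apply: (@vmon_inj _ _ _ D w); rewrite raddf0 -sigma_ker raddf_sum sigmaE.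
    rewrite -[RHS]/(rowcomb _ _) raddf_sum big_mkcond; apply: eq_bigr => i _.
    rewrite /= rowcomb_delta vlead_mon_g scale_vmon mxE ocoef_omon eqxx.
    case: ifPn => [/lam_w->//|]; rewrite negbK => /eqP->.
    by rewrite mul0r raddf0.
  apply: dominated_syz => // i => [t ai lt_t|].
    by rewrite mxE ocoef_omon (negPf (wo_lt_neq ltT_wo lt_t)).
  rewrite negbK => /eqP ai0; rewrite mxE ai0 /omon !scale0r.
  exact: dominated0.
(* All terms of the correction $h$ have degree strictly below $w$, so subtracting it cannot disturb
   the degree-$w$ part of $k$. *)
have [h [hE h_lt]] : exists h, syz g h = syz g k /\
    forall i t, ~~ ltM (tact t (gt i)) w -> ocoef t (h 0 i) = 0.
  have [k0|k_n0] := eqVneq (syz g k) 0.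
    exists 0; split; first by rewrite k0 -[syz g 0]/(rowcomb g 0) raddf0.
    by move=> i t _; rewrite mxE raddf0.
  have [w1 w1E lt_w1] := vlead_term_lt ltM_compat k_n0 k_w.
  have [h [hE h_w1]] := groebner_representation G w1E.
  exists h; split=> // i t nlt; apply: h_w1.
  have [->//|/(wo_total ltM_wo)] := eqVneq (tact t (gt i)) w.
  by rewrite (negPf nlt) /=; exact: (wo_trans ltM_wo lt_w1).
pose U := k - h.
have coefU i t : ocoef t (U 0 i) = a i *+ (lam i == t) - ocoef t (h 0 i).
  by rewrite !mxE raddfB /= ocoef_omon.
have U_lead i : a i != 0 ->
    [/\ U 0 i != 0, lead_term ltT (U 0 i) = lam i
      & ocoef (lam i) (U 0 i) = a i].
  move=> ai; have Ui : ocoef (lam i) (U 0 i) = a i.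
    by rewrite coefU eqxx h_lt ?subr0 // lam_w // (wo_irr ltM_wo).
  have Un0 : U 0 i != 0 by apply: contraNneq ai => U0; rewrite -Ui U0 raddf0.
  split=> //; apply/lead_termP => //; rewrite Ui; split=> // t lt_t.
  rewrite coefU (negPf (wo_lt_neq ltT_wo lt_t)) h_lt ?subr0 //.
  by rewrite -(lam_w i ai) (tact_lt ltT_term ltM_compat) wo_asym.
(* Where $\sigma$ has no entry, $U$ may still have one, coming from $h$; it is too small to enter
   the leading form. *)
have U_low i : a i = 0 -> U 0 i != 0 ->
    ltM (tact (lead_term ltT (U 0 i)) (gt i)) w.
  move=> ai Un0; have [+ _] := (lead_termP ltT_term _ Un0).1 erefl.
  rewrite coefU ai mul0rn sub0r oppr_eq0.
  by apply: contraNT => /h_lt->.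
(* Some entry of $\sigma$ is nonzero, so $w$ is attained and $v(U)=w$. *)
have [j aj] : exists j, a j != 0.
  apply/existsP; apply: contraNT sigma_n0 => /existsPn a0; rewrite sigmaE.
  by rewrite big1 // => i _; have /negbNE/eqP-> := a0 i; rewrite /omon !scale0r.
have U_deg : syz_deg ltT ltM g U = Some w.
  apply/(omaxP ltM_wo); split.
    have [Uj lam_j _] := U_lead j aj.
    rewrite mem_pmap; apply/mapP; exists j.
      by rewrite mem_filter Uj mem_enum.
    by rewrite syz_termE lam_j lam_w.
  move=> y; rewrite mem_pmap => /mapP[i].
  rewrite mem_filter syz_termE => /andP[Ui _] [->].
  have [/U_low/(_ Ui)|ai] := eqVneq (a i) 0; first exact: wo_asym.
  by have [_ -> _] := U_lead i ai; rewrite lam_w // (wo_irr ltM_wo).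
exists U; split.
  by rewrite -[syz g U]/(rowcomb g U) raddfB /= [X in _ - X]hE subrr.
rewrite sigmaE /lead_form U_deg big_mkcond; apply: eq_bigr => i _.
rewrite syz_termE; have [ai|ai] := eqVneq (a i) 0.
  rewrite ai /omon !scale0r; case: ifP => // /andP[/(U_low i ai) + /eqP[E]].
  by rewrite E (wo_irr ltM_wo).
have [Ui lam_i Ui_lam] := U_lead i ai.
by rewrite Ui /lead_mon lam_i lam_w // eqxx -/(ocoef _ _) Ui_lam.
Qed.

(** The image under $\mathfrak s_L$ of the leading form is a single monomial at $v(h)$, whose
    coefficient is that of $\mathfrak S_L(h)=0$ there. *)
Lemma lead_form_ker h :
  syz g h = 0 -> syz_lead ltM g (lead_form ltT ltM g h) = 0.
Proof.
move=> h_ker; rewrite -[LHS]/(rowcomb _ _) /lead_form.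
case E: (syz_deg ltT ltM g h) => [w|]; last first.
  by rewrite big_pred0 ?raddf0 // => i; rewrite syz_termE andbF.
have [_ w_max] := (omaxP ltM_wo _ _).1 E.
pose P i := (h 0 i != 0) && (syz_term ltT ltM g h i == Some w).
have Pw i : P i -> tact (lead_term ltT (h 0 i)) (gt i) = w.
  by move=> /andP[_]; rewrite syz_termE => /eqP[].
have h_max i t : h 0 i != 0 ->
    ltT (lead_term ltT (h 0 i)) t -> ocoef t (h 0 i) = 0.
  by move=> hi; have [_] := (lead_termP ltT_term _ hi).1 erefl; apply.
have [h_w _] : dominated ltM (syz g h) w
    (\sum_(i | P i) ocoef (lead_term ltT (h 0 i)) (h 0 i)
                    * talpha D (lead_term ltT (h 0 i)) (glc i)).
  apply: dominated_syz => // [i t /andP[/h_max h_i _]|i]; first exact: h_i.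
  rewrite negb_and negbK; have [->|hi] /= := eqVneq (h 0 i) 0.
    by rewrite scale0r => _; exact: dominated0.
  rewrite syz_termE => nw.
  (* A nonzero entry outside $P$ has degree different from the maximum $w$, hence below it, and
     contributes nothing at $w$. *)
  apply: (dominated_lt ltM_compat)
    (dominated_scale ltT_term ltM_compat (h_max i ^~ hi) (dominated_g i)) _.
  have /(wo_total ltM_wo)/orP[//|lt_w] :
      tact (lead_term ltT (h 0 i)) (gt i) != w.
    by apply: contraNneq nw => ->.
  have /w_max : tact (lead_term ltT (h 0 i)) (gt i) \in
      pmap (syz_term ltT ltM g h) [seq i <- enum 'I_u | h 0 i != 0].
    rewrite mem_pmap; apply/mapP; exists i; last by rewrite syz_termE.
    by rewrite mem_filter hi mem_enum.
  by rewrite lt_w.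
rewrite raddf_sum; transitivity (vmon D w (vcoef w (syz g h))).
  rewrite h_w raddf_sum; apply: eq_bigr => i /Pw i_w.
  by rewrite /= rowcomb_delta vlead_mon_g scale_vmon i_w.
by rewrite h_ker raddf0 raddf0.
Qed.

End Lifting.

Theorem theorem34 (R : nzRingType) (n m u : nat) (D : ore_data R n)
    (ltT : rel 'X_{1..n}) (ltM : rel ('X_{1..n} * 'I_m))
    (g : 'I_u -> 'rV[ore D]_m)
    (GM : 'rV[ore (graded D)]_u -> Prop) :
  is_domain R ->
  term_order ltT -> compatible_order ltT ltM ->
  (forall i, g i != 0) ->
  left_groebner ltM g ->
  gebauer_moller ltM g GM ->
  (forall sigma, GM sigma -> exists U, lifting ltT ltM g sigma U) /\
  (forall lift : 'rV[ore (graded D)]_u -> 'rV[ore D]_u,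
     (forall sigma, GM sigma -> lifting ltT ltM g sigma (lift sigma)) ->
     standard_basis ltT ltM g
       (fun U => syz g U = 0)
       (fun U => exists2 sigma, GM sigma & U = lift sigma)).
Proof.
move=> _ ltT_term ltM_compat g_n0 G [GM_homog GM_gen].
have [gt gtE] := fin_all_exists (fun i => vlead_term_ex ltM (g_n0 i)).
split=> [sigma sigma_GM|lift liftP].
  apply: (lifting_exists ltT_term ltM_compat gtE G (GM_homog _ sigma_GM)).
  by apply/GM_gen; exact: lspan_mem.
have lift_ker b : (exists2 sigma, GM sigma & b = lift sigma) -> syz g b = 0.
  by case=> sigma /liftP[ker_lift _] ->.
split=> // x; split.
  by apply: lspan_sub => y [h [/lift_ker h_ker h_n0 ->]]; exists h.
(* The kernel of $\mathfrak s_L$ is a submodule containing every leading form of a syzygy, hence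
   their whole span. *)
move=> x_N; have /GM_gen : syz_lead ltM g x = 0.
  apply: (lspan_ker (f := rowcomb (fun i => vlead_mon ltM (g i)))) x_N.
  by move=> y [h [h_ker _ ->]]; exact: (lead_form_ker ltT_term ltM_compat gtE).
apply: lspan_sub => sigma sigma_GM; have [_ lead_lift] := liftP _ sigma_GM.
exists (lift sigma); split=> //; first by exists sigma.
(* A zero lifting would have the empty sum as leading form, whereas $\sigma\ne0$. *)
have [sigma_n0 _] := GM_homog _ sigma_GM; apply: contraNneq sigma_n0 => lift0.
by rewrite -lead_lift lift0 /lead_form big_pred0 // => i; rewrite mxE eqxx.
Qed.
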